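(* Let $S_\infty$ be the group of finitely supported permutations of $\mathbb{N}$, equipped with the support norm $\|\sigma\|_{\mathrm{supp}}=|\{n\in\mathbb{N}:\sigma(n)\ne n\}|$. All asymptotic cones of $(S_\infty,\|\cdot\|_{\mathrm{supp}})$ are contractible; that is, $\mathrm{Cone}_\omega(S_\infty,s_n)$ is contractible for every non-principal ultrafilter $\omega$ on $\mathbb{N}$ and every scaling sequence $(s_n)$.
   Context: The norm induces the metric $d(\sigma,\tau)=\|\sigma\tau^{-1}\|_{\mathrm{supp}}$. A scaling sequence is a sequence $(s_n)$ of positive reals with $\lim_\omega s_n=\infty$. A sequence $(x_n)$ in $S_\infty$ is admissible if $\|x_n\|_{\mathrm{supp}}/s_n$ is bounded. $\mathrm{Cone}_\omega(S_\infty,s_n)$ is the metric space of admissible sequences modulo $(x_n)\sim(y_n)$ iff $\lim_\omega d(x_n,y_n)/s_n=0$, with metric $\lim_\omega d(x_n,y_n)/s_n$. *)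

(* Defs.v *)
From HB Require Import structures.
From mathcomp Require Import all_boot all_order all_algebra.
From mathcomp Require Import finmap.
From mathcomp Require Import all_classical all_reals all_analysis.

Set Implicit Arguments.
Unset Strict Implicit.
Unset Printing Implicit Defensive.

Import Order.TTheory GRing.Theory Num.Theory.
Import numFieldNormedType.Exports.

Local Open Scope classical_set_scope.
Local Open Scope ring_scope.

Section finitary_permutations.

Definition supp (f : nat -> nat) : set nat := [set n | f n <> n].

Definition finitary_perm : pred (nat -> nat) :=
  fun f => `[< bijective f /\ finite_set (supp f) >].

Record Sinf := MkSinf { perm_fun :> nat -> nat ; _ : finitary_perm perm_fun }.

HB.instance Definition _ := [isSub for perm_fun].
HB.instance Definition _ := [Choice of Sinf by <:].

Lemma Sinf_bij (x : Sinf) : bijective x.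
Proof. by case: x => f /= /asboolP[]. Qed.

Lemma Sinf_finite (x : Sinf) : finite_set (supp x).
Proof. by case: x => f /= /asboolP[]. Qed.

Lemma Sinf_eqP (x y : Sinf) : x =1 y -> x = y.
Proof. by move=> xy; apply/val_inj/funext. Qed.

Lemma Sinf_inv_exists (x : Sinf) : exists g, cancel x g /\ cancel g x.
Proof. by case: (Sinf_bij x) => g xg gx; exists g. Qed.

Definition inv_fun (x : Sinf) : nat -> nat := projT1 (cid (Sinf_inv_exists x)).

Lemma inv_funK (x : Sinf) : cancel x (inv_fun x).
Proof. by rewrite /inv_fun; case: cid => g []. Qed.

Lemma inv_funKV (x : Sinf) : cancel (inv_fun x) x.
Proof. by rewrite /inv_fun; case: cid => g []. Qed.

Lemma supp_inv_fun (x : Sinf) : supp (inv_fun x) = supp x.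
Proof.
apply/seteqP; split=> n /= + E; apply.
- by rewrite -{1}E inv_funK.
- by rewrite -{1}E inv_funKV.
Qed.

Lemma supp_comp f g : supp (f \o g) `<=` supp f `|` supp g.
Proof.
move=> n; rewrite /supp /=; have [->|] := pselect (g n = n); first by left.
by right.
Qed.

Fact Sinf_one_subproof : finitary_perm id.
Proof.
apply/asboolP; split; first by exists id.
by rewrite (_ : supp id = set0)//; apply/seteqP; split=> n.
Qed.

Fact Sinf_mul_subproof (x y : Sinf) : finitary_perm (x \o y).
Proof.
apply/asboolP; split; first exact: bij_comp (Sinf_bij x) (Sinf_bij y).
apply: sub_finite_set (@supp_comp x y) _.
by rewrite finite_setU; split; exact: Sinf_finite.
Qed.

Fact Sinf_inv_subproof (x : Sinf) : finitary_perm (inv_fun x).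
Proof.
apply/asboolP; split; first by exists x; [exact: inv_funKV|exact: inv_funK].
by rewrite supp_inv_fun; exact: Sinf_finite.
Qed.

(* The product is composition of functions: (x * y) n = x (y n). *)
Definition Sinf_one : Sinf := MkSinf Sinf_one_subproof.
Definition Sinf_mul (x y : Sinf) : Sinf := MkSinf (Sinf_mul_subproof x y).
Definition Sinf_inv (x : Sinf) : Sinf := MkSinf (Sinf_inv_subproof x).

Fact Sinf_mulgA : associative Sinf_mul.
Proof. by move=> x y z; apply: Sinf_eqP. Qed.
Fact Sinf_mul1g : left_id Sinf_one Sinf_mul.
Proof. by move=> x; apply: Sinf_eqP. Qed.
Fact Sinf_mulg1 : right_id Sinf_one Sinf_mul.
Proof. by move=> x; apply: Sinf_eqP. Qed.
Fact Sinf_mulVg : left_inverse Sinf_one Sinf_inv Sinf_mul.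
Proof. by move=> x; apply: Sinf_eqP => n /=; rewrite inv_funK. Qed.
Fact Sinf_mulgV : right_inverse Sinf_one Sinf_inv Sinf_mul.
Proof. by move=> x; apply: Sinf_eqP => n /=; rewrite inv_funKV. Qed.

HB.instance Definition _ :=
  isGroup.Build Sinf Sinf_mulgA Sinf_mul1g Sinf_mulg1 Sinf_mulVg Sinf_mulgV.

Definition supp_norm (x : Sinf) : nat := #|` fset_set (supp x)|.

Definition supp_dist (x y : Sinf) : nat := supp_norm (x * y^-1)%g.

Lemma supp_norm1 : supp_norm 1%g = 0%N.
Proof.
rewrite /supp_norm (_ : supp _ = set0) ?fset_set0 ?cardfs0//.
by apply/seteqP; split=> n.
Qed.

Lemma supp_normV x : supp_norm (x^-1)%g = supp_norm x.
Proof. by rewrite /supp_norm supp_inv_fun. Qed.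

Lemma supp_normM x y : (supp_norm (x * y)%g <= supp_norm x + supp_norm y)%N.
Proof.
have fx := Sinf_finite x; have fy := Sinf_finite y.
apply: (@leq_trans #|` fset_set (supp x `|` supp y)|).
  apply: fsubset_leq_card; rewrite -fset_set_sub.
  - exact: supp_comp.
  - exact: Sinf_finite.
  - by rewrite finite_setU.
by rewrite fset_setU// cardfsU leq_subr.
Qed.

Lemma supp_distxx x : supp_dist x x = 0%N.
Proof. by rewrite /supp_dist mulgV supp_norm1. Qed.

Lemma supp_distC x y : supp_dist x y = supp_dist y x.
Proof. by rewrite /supp_dist -supp_normV invgM invgK. Qed.

Lemma supp_dist_triangle y x z :
  (supp_dist x z <= supp_dist x y + supp_dist y z)%N.
Proof.
rewrite /supp_dist; apply: leq_trans (supp_normM _ _).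
by rewrite mulgA mulgVK.
Qed.

Lemma supp_dist_le x y : (supp_dist x y <= supp_norm x + supp_norm y)%N.
Proof. by rewrite /supp_dist -[X in (_ + X)%N]supp_normV supp_normM. Qed.

End finitary_permutations.

Record nonprincipal_ultrafilter (T : Type) := NonprincipalUltrafilter {
  ultra_sets :> set_system T ;
  ultra_filter : UltraFilter ultra_sets ;
  ultra_nonprincipal : forall x : T, ultra_sets <> principal_filter x }.

#[global] Existing Instance ultra_filter.

Record scaling_sequence (R : realType) (omega : nonprincipal_ultrafilter nat) :=
  ScalingSequence {
    scale :> nat -> R ;
    scale_gt0 : forall n, 0 < scale n ;
    scale_cvgy : scale n @[n --> ultra_sets omega] --> +oo }.

Section asymptotic_cone.
Variables (R : realType) (omega : nonprincipal_ultrafilter nat).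
Variable s : scaling_sequence R omega.

Definition admissible (x : nat -> Sinf) : Prop :=
  exists M : R, forall n, (supp_norm (x n))%:R / s n <= M.

Record admissible_seq :=
  AdmissibleSeq { aseq :> nat -> Sinf ; _ : `[< admissible aseq >] }.

HB.instance Definition _ := [isSub for aseq].
HB.instance Definition _ := [Choice of admissible_seq by <:].

Definition scaled_dist (x y : admissible_seq) (n : nat) : R :=
  (supp_dist (x n) (y n))%:R / s n.

Definition cone_equiv (x y : admissible_seq) : bool :=
  `[< scaled_dist x y n @[n --> ultra_sets omega] --> (0 : R) >].

Lemma scaled_dist_ge0 x y n : 0 <= scaled_dist x y n.
Proof. by rewrite divr_ge0// ltW// scale_gt0. Qed.

Lemma scaled_distxx x n : scaled_dist x x n = 0.
Proof. by rewrite /scaled_dist supp_distxx mul0r. Qed.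

Lemma scaled_distC x y n : scaled_dist x y n = scaled_dist y x n.
Proof. by rewrite /scaled_dist supp_distC. Qed.

Lemma scaled_dist_triangle y x z n :
  scaled_dist x z n <= scaled_dist x y n + scaled_dist y z n.
Proof.
rewrite -mulrDl ler_pM2r ?invr_gt0 ?scale_gt0// -natrD ler_nat.
exact: supp_dist_triangle.
Qed.

Lemma scaled_dist_cvg x y : cvg (scaled_dist x y n @[n --> ultra_sets omega]).
Proof.
have [M xM] : admissible x by case: x => ? /= /asboolP.
have [N yN] : admissible y by case: y => ? /= /asboolP.
have bnd n : scaled_dist x y n \in `[0, M + N].
  rewrite in_itv /= scaled_dist_ge0 /=; apply: le_trans (lerD (xM n) (yN n)).
  rewrite -mulrDl ler_pM2r ?invr_gt0 ?scale_gt0// -natrD ler_nat.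
  exact: supp_dist_le.
have [|l [_ ll]] := @segment_compact R 0 (M + N)
  (scaled_dist x y n @[n --> ultra_sets omega]) _.
  by apply: filterS (@filterT _ omega _) => n _; exact: bnd.
apply/cvg_ex; exists l => U lU.
have [//|oU] := in_ultra_setVsetC (scaled_dist x y @^-1` U)
  (ultra_filter omega).
by have [r [/= nr Ur]] := ll (~` U) _ oU lU.
Qed.

Fact cone_equiv_refl : reflexive cone_equiv.
Proof.
move=> x; apply/asboolP.
under eq_fun do rewrite scaled_distxx.
exact: cvg_cst.
Qed.

Fact cone_equiv_sym : symmetric cone_equiv.
Proof.
move=> x y; apply/asboolP/asboolP => h;
by under eq_fun do rewrite scaled_distC.
Qed.

Fact cone_equiv_trans : transitive cone_equiv.
Proof.
move=> y x z /asboolP xy /asboolP yz; apply/asboolP.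
apply: (@squeeze_cvgr _ _ _ _ (cst 0) (scaled_dist x y \+ scaled_dist y z)).
- by near=> n; rewrite scaled_dist_ge0 scaled_dist_triangle.
- exact: cvg_cst.
- by rewrite -[X in _ --> X]addr0; exact: cvgD.
Unshelve. all: by end_near. Qed.

Canonical cone_equiv_rel :=
  EquivRel cone_equiv cone_equiv_refl cone_equiv_sym cone_equiv_trans.

Local Open Scope quotient_scope.

Definition Cone : Type := {eq_quot cone_equiv}.

HB.instance Definition _ := Choice.on Cone.
HB.instance Definition _ := EqQuotient.on Cone.

(* The limit exists for all admissible sequences (scaled_dist_cvg), and the
   value does not depend on the representatives (cone_dist_pi). *)
Definition cone_dist (p q : Cone) : R :=
  lim (scaled_dist (repr p) (repr q) n @[n --> ultra_sets omega]).

Lemma cone_eqP (x y : admissible_seq) :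
  reflect (\pi_Cone x = \pi_Cone y)
          `[< scaled_dist x y n @[n --> ultra_sets omega] --> (0 : R) >].
Proof. by apply: (iffP idP) => [?|/eqmodP]//; exact/eqmodP. Qed.

Lemma scaled_dist_lim_triangle y x z :
  lim (scaled_dist x z n @[n --> ultra_sets omega]) <=
  lim (scaled_dist x y n @[n --> ultra_sets omega]) +
  lim (scaled_dist y z n @[n --> ultra_sets omega]).
Proof.
rewrite -limD; [|exact: scaled_dist_cvg|exact: scaled_dist_cvg].
apply: ler_lim; [exact: scaled_dist_cvg| |].
- by apply: is_cvgD; exact: scaled_dist_cvg.
- by near=> n; exact: scaled_dist_triangle.
Unshelve. all: by end_near. Qed.

Lemma scaled_dist_limC x y :
  lim (scaled_dist x y n @[n --> ultra_sets omega]) =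
  lim (scaled_dist y x n @[n --> ultra_sets omega]).
Proof. by under eq_fun do rewrite scaled_distC. Qed.

Lemma scaled_dist_lim_equiv x x' y y' :
  cone_equiv x x' -> cone_equiv y y' ->
  lim (scaled_dist x y n @[n --> ultra_sets omega]) <=
  lim (scaled_dist x' y' n @[n --> ultra_sets omega]).
Proof.
move=> /asboolP/cvg_lim xx'; rewrite /cone_equiv => /asboolP/cvg_lim yy'.
apply: le_trans (scaled_dist_lim_triangle x' x y) _.
rewrite xx'// add0r; apply: le_trans (scaled_dist_lim_triangle y' x' y) _.
by rewrite (scaled_dist_limC y') yy'// addr0.
Qed.

Lemma cone_dist_pi (x y : admissible_seq) :
  cone_dist (\pi_Cone x) (\pi_Cone y) =
  lim (scaled_dist x y n @[n --> ultra_sets omega]).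
Proof.
have reprP (z : admissible_seq) : cone_equiv (repr (\pi_Cone z)) z.
  by apply/eqmodP; rewrite reprK.
apply/eqP; rewrite eq_le; apply/andP; split; apply: scaled_dist_lim_equiv => //.
all: by rewrite cone_equiv_sym.
Qed.

Fact cone_distxx p : cone_dist p p = 0.
Proof.
rewrite /cone_dist; under eq_fun do rewrite scaled_distxx.
exact: lim_cst.
Qed.

Fact cone_dist_positivity p q : cone_dist p q = 0 -> p = q.
Proof.
rewrite /cone_dist => pq0; rewrite -[p]reprK -[q]reprK.
by apply/cone_eqP/asboolP; rewrite -pq0; exact: scaled_dist_cvg.
Qed.

Fact cone_distC p q : cone_dist p q = cone_dist q p.
Proof. exact: scaled_dist_limC. Qed.

Fact cone_dist_triangle q p r :
  cone_dist p r <= cone_dist p q + cone_dist q r.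
Proof. exact: scaled_dist_lim_triangle. Qed.

HB.instance Definition _ := isMetric.Build R Cone
  cone_distxx cone_dist_positivity cone_distC cone_dist_triangle.

Lemma cone_mdistE (p q : Cone) : mdist p q = cone_dist p q.
Proof. by []. Qed.

End asymptotic_cone.

(* R only provides the unit interval: the domain [0, 1] x X of a homotopy
   carries the subspace topology of R x X. *)
Definition homotopic (R : realType) (X Y : topologicalType) (f g : X -> Y) :=
  exists H : R * X -> Y,
    [/\ {within `[0, 1] `*` [set: X], continuous H},
        forall x, H (0, x) = f x &
        forall x, H (1, x) = g x].

Definition contractible (R : realType) (X : topologicalType) :=
  exists x0 : X, homotopic R (@idfun X) (cst x0).

(* Main.v *)
Require Import Defs.
From mathcomp Require Import all_boot all_order all_algebra.
From mathcomp Require Import finmap zify lra.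
From mathcomp Require Import all_classical all_reals all_analysis.

(* Bypassing a point p of a permutation x (sending the preimage of p to x p and
   fixing p) is 1-Lipschitz in x for the support metric and moves x by at most
   2.  Bypassing, for t in [0, 1], the first floor(t * ||x||) points of the
   support of x thus deforms x into the identity.  Since the supports of x and y
   differ by at most d(x, y) points, this deformation is Lipschitz in x, and in t
   with constant O(||x||), up to a bounded error that vanishes in the cone. *)

Set Implicit Arguments.
Unset Strict Implicit.
Unset Printing Implicit Defensive.

Import Order.TTheory GRing.Theory Num.Theory.
Import numFieldNormedType.Exports.

Local Open Scope classical_set_scope.

(** * The support distance as a count of disagreements *)

Definition disagreement (x y : Sinf) : set nat := [set n | x n <> y n].

Lemma disagreement_finite x y : finite_set (disagreement x y).
Proof.
apply: (@sub_finite_set _ _ (supp x `|` supp y)); last first.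
  by rewrite finite_setU; split; exact: Sinf_finite.
move=> n /= xy; have [xn|] := pselect (x n = n); last by left.
by right => yn; apply: xy; rewrite xn yn.
Qed.

Lemma mem_disagreement x y n :
  (n \in fset_set (disagreement x y)) = (x n != y n).
Proof.
rewrite in_fset_set; last exact: disagreement_finite.
by apply/idP/idP => [/set_mem/eqP|/eqP/mem_set].
Qed.

(** The product [x * y^-1] moves exactly the images under the injection [y] of the points where [x]
    and [y] differ. *)
Lemma supp_distE x y : supp_dist x y = #|` fset_set (disagreement x y)|.
Proof.
rewrite /supp_dist /supp_norm.
have -> : supp (x * y^-1)%g = y @` disagreement x y.
  apply/seteqP; split=> [n /= xyn|_ [n /= xyn <-] /=].
    exists ((y^-1)%g n); last exact: inv_funKV.
    by move: xyn; rewrite /disagreement /supp /= inv_funKV.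
  by rewrite /supp /= Defs.inv_funK.
rewrite fset_set_image; last exact: disagreement_finite.
by rewrite card_imfset//=; exact/bij_inj/Sinf_bij.
Qed.

Lemma supp_norm_dist x : supp_norm x = supp_dist x 1%g.
Proof. by rewrite /supp_dist invg1 mulg1. Qed.

(** * Transpositions and the bypass of one point *)

Definition swap_fun (p q n : nat) :=
  if n == p then q else if n == q then p else n.

Lemma swap_funK p q : involutive (swap_fun p q).
Proof. by move=> n; rewrite /swap_fun; do !case: ifP => //; lia. Qed.

Fact swap_subproof p q : finitary_perm (swap_fun p q).
Proof.
apply/asboolP; split; first by exists (swap_fun p q); exact: swap_funK.
apply: (@sub_finite_set _ _ [set p; q]); last exact: finite_set2.
move=> n /=; rewrite /supp /swap_fun /=.
by case: eqP => [|_]; [left|case: eqP => [|//]; right].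
Qed.

Definition swap p q : Sinf := MkSinf (swap_subproof p q).

Lemma supp_norm_swap p q : (supp_norm (swap p q) <= 2)%N.
Proof.
rewrite supp_norm_dist supp_distE.
apply: (@leq_trans #|` [fset p; q]%fset|); last by rewrite cardfs2; case: eqP.
apply/fsubset_leq_card/fsubsetP => n.
rewrite mem_disagreement !inE /= /swap_fun.
by do !case: eqP => //.
Qed.

(** In cycle notation, this deletes [p] from its cycle. *)
Definition bypass (p : nat) (x : Sinf) : Sinf := (swap p (x p) * x)%g.

Lemma bypassE p x n :
  bypass p x n = if n == p then p else if x n == p then x p else x n.
Proof.
rewrite /= /swap_fun; case: (n =P p) => [->|np].
  by rewrite eqxx; case: eqP.
case: eqP => // _; case: eqP => // xnp.
by case: np; exact: (bij_inj (Sinf_bij x)).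
Qed.

Lemma bypass_fixed p (x : Sinf) n : x n = n -> bypass p x n = n.
Proof. by rewrite bypassE => ->; case: eqP. Qed.

Lemma bypass_id p (x : Sinf) : x p = p -> bypass p x = x.
Proof.
move=> xp; apply: Sinf_eqP => n; rewrite bypassE.
by case: eqP => [->|_]; [rewrite xp|case: eqP => // ->].
Qed.

Lemma supp_dist_bypass_id p x : (supp_dist (bypass p x) x <= 2)%N.
Proof. by rewrite /supp_dist mulgK supp_norm_swap. Qed.

(* If x and y agree at n but their bypasses do not, then n is the common
   preimage of p and x, y disagree at p. *)
Lemma supp_dist_bypass p x y :
  (supp_dist (bypass p x) (bypass p y) <= supp_dist x y)%N.
Proof.
(* The map [f] injects the disagreements of the bypasses into those of [x] and [y]: it keeps a point
   where [x] and [y] already differ and sends the only possible other one to [p], which is not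
   itself a disagreement of the bypasses. *)
rewrite !supp_distE; pose f n := if x n == y n then p else n.
have fP n : bypass p x n != bypass p y n ->
    [/\ n <> p, x (f n) != y (f n) & x n = y n -> x n = p].
  rewrite !bypassE /f; case: (n =P p) => [_|np]; first by rewrite eqxx.
  case: (x n =P y n) => [<-|] //.
    by case: (x n =P p) => [//|]; rewrite eqxx.
  by move=> xy _; split => //; exact/eqP.
rewrite -(size_map f); apply: uniq_leq_size => [|_ /mapP[n + ->]]; last first.
  by rewrite !mem_disagreement => /fP[].
rewrite map_inj_in_uniq ?fset_uniq// => n m.
rewrite !mem_disagreement => /fP[np _ xn] /fP[mp _ xm].
rewrite /f; case: eqP => [/xn xnp|_]; case: eqP => [/xm xmp|_] //.
- by move=> _; apply: (bij_inj (Sinf_bij x)); rewrite xnp.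
- by move=> /esym.
Qed.

(** * Bypassing all points below a threshold *)

Fixpoint bypass_below (N : nat) (x : Sinf) : Sinf :=
  if N is N'.+1 then bypass N' (bypass_below N' x) else x.

Lemma supp_dist_bypass_below N x y :
  (supp_dist (bypass_below N x) (bypass_below N y) <= supp_dist x y)%N.
Proof.
by elim: N => //= N; apply: leq_trans; exact: supp_dist_bypass.
Qed.

Lemma bypass_below_fixed N (x : Sinf) n : x n = n -> bypass_below N x n = n.
Proof. by move=> xn; elim: N => //= N; exact: bypass_fixed. Qed.

Lemma bypass_below_lt N x n : (n < N)%N -> bypass_below N x n = n.
Proof.
elim: N => // N IHN; rewrite ltnS leq_eqVlt => /orP[/eqP->|/IHN].
  by rewrite [bypass_below _ _]/= bypassE eqxx.
exact: bypass_fixed.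
Qed.

Lemma bypass_below1 N : bypass_below N 1%g = 1%g.
Proof. by apply: Sinf_eqP => n; rewrite bypass_below_fixed. Qed.

Lemma supp_norm_bypass_below N x :
  (supp_norm (bypass_below N x) <= supp_norm x)%N.
Proof.
by rewrite !supp_norm_dist -{1}(bypass_below1 N) supp_dist_bypass_below.
Qed.

(** * Counting support points below a threshold *)

(** Stages of the deformation are compared through this count, because the gap between two
    thresholds does not control the distance. *)
Definition supp_below (x : Sinf) (N : nat) : nat :=
  count (fun n => x n != n) (iota 0 N).

Lemma supp_belowS x N :
  supp_below x N.+1 = (supp_below x N + (x N != N))%N.
Proof. by rewrite /supp_below -addn1 iotaD count_cat /= addn0. Qed.

Lemma supp_below_le x N M : (N <= M)%N -> (supp_below x N <= supp_below x M)%N.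
Proof. by move=> /subnKC <-; rewrite /supp_below iotaD count_cat leq_addr. Qed.

(** A point moved by [x] and fixed by [y] is a disagreement. *)
Lemma supp_below_dist x y N :
  (supp_below x N <= supp_below y N + supp_dist x y)%N.
Proof.
pose p n := x n != y n.
apply: (@leq_trans (supp_below y N + count p (iota 0 N))).
  rewrite /supp_below -count_predUI; apply: leq_trans (leq_addr _ _).
  apply: sub_count => n /=; rewrite /p; apply: contraR.
  by rewrite negb_or !negbK => /andP[/eqP + /eqP ->] => ->.
rewrite leq_add2l -size_filter supp_distE.
rewrite uniq_leq_size ?filter_uniq ?iota_uniq//.
by move=> n; rewrite mem_filter mem_disagreement => /andP[].
Qed.

Lemma supp_below_le_norm x N : (supp_below x N <= supp_norm x)%N.
Proof.
rewrite supp_norm_dist (leq_trans (supp_below_dist x 1%g N))//.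
rewrite /supp_below (@eq_count _ _ pred0) ?count_pred0// => n.
by rewrite /= eqxx.
Qed.

Lemma supp_bounded (x : Sinf) : exists N, forall n, (N <= n)%N -> x n = n.
Proof.
exists (\max_(n <- fset_set (disagreement x 1%g)) n).+1 => n.
rewrite ltnNge => /negP nN; apply/eqP/negP => /negP xn; apply: nN.
by apply: leq_bigmax_seq => //; rewrite mem_disagreement.
Qed.

Lemma supp_below_bound (x : Sinf) N :
  (forall n, (N <= n)%N -> x n = n) -> supp_below x N = supp_norm x.
Proof.
move=> xN; apply/eqP; rewrite eqn_leq supp_below_le_norm/=.
rewrite supp_norm_dist supp_distE /supp_below -size_filter.
apply: uniq_leq_size => // n.
rewrite mem_disagreement mem_filter mem_iota /= => xn.
by rewrite xn /= ltnNge; apply/negP => /xN xnn; rewrite xnn eqxx in xn.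
Qed.

(** Discrete intermediate values: the count starts at 0, grows by at most 1 per step and reaches the
    norm. *)
Lemma supp_below_surj x k :
  (k <= supp_norm x)%N -> exists N, supp_below x N = k.
Proof.
have [M xM] := supp_bounded x; rewrite -(supp_below_bound xM).
elim: M {xM} => [|M IHM]; first by rewrite leqn0 => /eqP ->; exists 0%N.
rewrite leq_eqVlt => /orP[/eqP ->|]; first by exists M.+1.
rewrite supp_belowS => kM; apply: IHM; case: (_ != _) kM; lia.
Qed.

(** Bypassing one more point costs at most 2, and costs nothing at a fixed point of [x], which
    earlier bypasses leave fixed. *)
Lemma supp_dist_bypass_below_le N M x : (N <= M)%N ->
  (supp_dist (bypass_below N x) (bypass_below M x) <=
   2 * (supp_below x M - supp_below x N))%N.
Proof.
move=> /subnK <-; elim: (M - N)%N => [|k IHk]; first by rewrite supp_distxx.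
rewrite addSn supp_belowS [bypass_below _.+1 _]/=.
set K := (k + N)%N in IHk *.
have [xK|xK] := eqVneq (x K) K.
  by rewrite bypass_id ?addn0 ?bypass_below_fixed.
have le : (supp_below x N <= supp_below x K)%N.
  by rewrite supp_below_le ?leq_addl.
have := supp_dist_triangle (bypass_below K x) (bypass_below N x)
  (bypass K (bypass_below K x)).
have := supp_dist_bypass_id K (bypass_below K x); rewrite supp_distC.
by move: IHk le; rewrite /=; lia.
Qed.

Lemma supp_norm_bypass_below0 x N :
  supp_below x N = supp_norm x -> supp_norm (bypass_below N x) = 0%N.
Proof.
move=> xN; have [M xM] := supp_bounded x; pose K := maxn M N.
have xK n : (K <= n)%N -> x n = n by rewrite geq_max => /andP[/xM].
have -> : supp_norm (bypass_below N x) =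
    supp_dist (bypass_below N x) (bypass_below K x).
  rewrite supp_norm_dist; congr (supp_dist _ _); apply: Sinf_eqP => n /=.
  have [/bypass_below_lt -> //|/xK xn] := ltnP n K.
  by rewrite bypass_below_fixed.
apply/eqP; rewrite -leqn0 (leq_trans (supp_dist_bypass_below_le _ _))//.
  exact: leq_maxr.
by rewrite (supp_below_bound xK) xN subnn.
Qed.

(* Meaningful only for k at most the norm of x; otherwise no such N exists and
   the value is 0. *)
Definition cutoff (x : Sinf) (k : nat) : nat :=
  xget 0%N [set N | supp_below x N = k].

Lemma cutoffP x k : (k <= supp_norm x)%N -> supp_below x (cutoff x k) = k.
Proof.
move=> /supp_below_surj[N xN]; rewrite /cutoff.
by case: xgetP => [_ -> //|/(_ N)].
Qed.

Definition shrink (k : nat) (x : Sinf) : Sinf := bypass_below (cutoff x k) x.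

Lemma supp_norm_shrink k x : (supp_norm (shrink k x) <= supp_norm x)%N.
Proof. exact: supp_norm_bypass_below. Qed.

Lemma shrink0 x : supp_dist (shrink 0 x) x = 0%N.
Proof.
apply/eqP; rewrite -leqn0 supp_distC.
apply: leq_trans (supp_dist_bypass_below_le x (leq0n _)) _.
by rewrite cutoffP.
Qed.

Lemma shrink_norm x : supp_dist (shrink (supp_norm x) x) 1%g = 0%N.
Proof. by rewrite -supp_norm_dist supp_norm_bypass_below0 ?cutoffP. Qed.

Lemma supp_dist_shrink x y k l :
  (k <= supp_norm x)%N -> (l <= supp_norm y)%N ->
  (supp_dist (shrink k x) (shrink l y) <=
   3 * supp_dist x y + 2 * ((k - l) + (l - k)))%N.
Proof.
move=> /cutoffP xk /cutoffP yl; rewrite /shrink.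
set N := cutoff x k in xk *; set M := cutoff y l in yl *.
have := supp_dist_triangle (bypass_below N y) (bypass_below N x)
  (bypass_below M y).
have := supp_dist_bypass_below N x y.
have := supp_below_dist x y N; have := supp_below_dist y x N.
rewrite (supp_distC y x).
have [NM|/ltnW MN] := leqP N M.
  by have := supp_dist_bypass_below_le y NM; lia.
by have := supp_dist_bypass_below_le y MN; rewrite supp_distC; lia.
Qed.

Local Open Scope ring_scope.
Local Open Scope quotient_scope.

Section contraction.
Variables (R : realType) (omega : nonprincipal_ultrafilter nat).
Variable s : scaling_sequence R omega.

Definition level (t : R) (x : Sinf) : nat := Num.truncn (t * (supp_norm x)%:R).

Lemma level_le t x : t <= 1 -> (level t x <= supp_norm x)%N.
Proof.
move=> t1; rewrite truncn_le_nat (@le_lt_trans _ _ (supp_norm x)%:R) ?ltr_nat//.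
by rewrite ler_piMl.
Qed.

Lemma level_sub t u x y : 0 <= t <= 1 -> 0 <= u <= 1 ->
  (level t x - level u y)%:R <=
  `|t - u| * (supp_norm x)%:R + (supp_dist x y)%:R + 1 :> R.
Proof.
move=> /andP[t0 t1] /andP[u0 u1].
have [lt|/ltnW le] := leqP (level t x) (level u y).
  by move: lt; rewrite -subn_eq0 => /eqP ->; rewrite !addr_ge0 ?mulr_ge0.
rewrite natrB//.
have /andP[+ _] : (level t x)%:R <= t * (supp_norm x)%:R < (level t x).+1%:R.
  by rewrite truncn_itv// mulr_ge0.
have : u * (supp_norm y)%:R < (level u y).+1%:R by rewrite truncnS_gt.
have xy : (supp_norm x)%:R <= (supp_norm y)%:R + (supp_dist x y)%:R :> R.
  rewrite -natrD ler_nat !supp_norm_dist addnC; exact: supp_dist_triangle.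
have : u * ((supp_norm x)%:R - (supp_norm y)%:R) <= (supp_dist x y)%:R.
  apply: (@le_trans _ _ (u * (supp_dist x y)%:R)); last by rewrite ler_piMl.
  by apply: ler_wpM2l; lra.
have : (t - u) * (supp_norm x)%:R <= `|t - u| * (supp_norm x)%:R.
  by rewrite ler_wpM2r// ler_norm.
rewrite -[in (level u y).+1%:R]addn1 natrD; lra.
Qed.

Lemma supp_dist_shrink_level t u x y : 0 <= t <= 1 -> 0 <= u <= 1 ->
  (supp_dist (shrink (level t x) x) (shrink (level u y) y))%:R <=
  9 * (supp_dist x y)%:R + 4 * (`|t - u| * (supp_norm x)%:R) + 4 :> R.
Proof.
move=> t01 u01; have /andP[t0 t1] := t01; have /andP[u0 u1] := u01.
have := supp_dist_shrink (level_le x t1) (level_le y u1).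
rewrite -(ler_nat R) natrD !natrM natrD.
have := level_sub x y t01 u01; have := level_sub y x u01 t01.
rewrite distrC (supp_distC y x).
have yx : (supp_norm y)%:R <= (supp_norm x)%:R + (supp_dist x y)%:R :> R.
  rewrite -natrD ler_nat !supp_norm_dist addnC (supp_distC x y).
  exact: supp_dist_triangle.
have tu : `|t - u| <= 1 by rewrite ler_norml; lra.
have : `|t - u| * (supp_norm y)%:R <=
    `|t - u| * (supp_norm x)%:R + (supp_dist x y)%:R.
  apply: (le_trans (ler_wpM2l (normr_ge0 _) yx)).
  by rewrite mulrDr lerD2l ler_piMl.
lra.
Qed.

Lemma aseq_admissible (x : admissible_seq s) : admissible s x.
Proof. by case: x => x /= /asboolP. Qed.

Fact contract_subproof (t : R) (x : admissible_seq s) :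
  `[< admissible s (fun n => shrink (level t (x n)) (x n)) >].
Proof.
apply/asboolP; have [M xM] := aseq_admissible x; exists M => n.
apply: le_trans (xM n); rewrite ler_pM2r ?invr_gt0 ?scale_gt0// ler_nat.
exact: supp_norm_shrink.
Qed.

Definition contract t x : admissible_seq s :=
  AdmissibleSeq (contract_subproof t x).

Lemma scale_inv_cvg0 : (scale s n)^-1 @[n --> ultra_sets omega] --> (0 : R).
Proof.
apply/(@gtr0_cvgV0 R nat omega _ (scale s)); last exact: scale_cvgy.
by near=> n; exact: scale_gt0.
Unshelve. all: by end_near. Qed.

Lemma contract_dist (x : admissible_seq s) : exists2 M : R, 0 <= M &
  forall t u (y : admissible_seq s), 0 <= t <= 1 -> 0 <= u <= 1 ->
  cone_dist (\pi_(Cone s) (contract t x)) (\pi_(Cone s) (contract u y)) <=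
  9 * cone_dist (\pi_(Cone s) x) (\pi_(Cone s) y) + 4 * (`|t - u| * M).
Proof.
have [M xM] := aseq_admissible x; exists M => [|t u y t01 u01].
  by apply: le_trans (xM 0%N); rewrite divr_ge0// ltW// scale_gt0.
pose c := 4 * (`|t - u| * M).
pose b n := 9 * scaled_dist x y n + c + 4 * (scale s n)^-1.
have bP : b n @[n --> ultra_sets omega] -->
    9 * lim (scaled_dist x y n @[n --> ultra_sets omega]) + c + 4 * 0.
  apply: cvgD; last exact: (cvgM (cvg_cst _) scale_inv_cvg0).
  apply: cvgD; last exact: cvg_cst.
  by apply: cvgM; [exact: cvg_cst|exact: scaled_dist_cvg].
rewrite mulr0 addr0 in bP.
rewrite !cone_dist_pi -/c -(cvg_lim _ bP)//.
apply: ler_lim; [exact: scaled_dist_cvg|by apply: cvgP bP|].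
near=> n; rewrite /b /c /scaled_dist /=.
have s0 : 0 < (scale s n)^-1 by rewrite invr_gt0 scale_gt0.
have := supp_dist_shrink_level (x n) (y n) t01 u01.
rewrite -(ler_pM2r s0).
have := ler_wpM2l (normr_ge0 (t - u)) (xM n).
lra.
Unshelve. all: by end_near. Qed.

Definition cone_contract (z : R * Cone s) : Cone s :=
  \pi_(Cone s) (contract z.1 (repr z.2)).

Lemma cone_contract0 p : cone_contract (0, p) = p.
Proof.
rewrite -[RHS]reprK; apply/cone_eqP/asboolP.
rewrite (_ : scaled_dist _ _ = cst 0); first exact: cvg_cst.
apply/funext => n; rewrite /scaled_dist /= /level mul0r truncn0.
by rewrite shrink0 mul0r.
Qed.

Fact trivial_subproof : `[< admissible s (fun=> 1%g) >].
Proof. by apply/asboolP; exists 0 => n; rewrite supp_norm1 mul0r. Qed.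

Definition cone_base : Cone s := \pi_(Cone s) (AdmissibleSeq trivial_subproof).

Lemma cone_contract1 p : cone_contract (1, p) = cone_base.
Proof.
apply/cone_eqP/asboolP.
rewrite (_ : scaled_dist _ _ = cst 0); first exact: cvg_cst.
apply/funext => n; rewrite /scaled_dist /= /level mul1r natrK.
by rewrite shrink_norm mul0r.
Qed.

Lemma cone_contract_continuous :
  {within `[0, 1] `*` [set: Cone s], continuous cone_contract}.
Proof.
apply/subspace_continuousP => -[t p] /= [/= t01 _].
have [M M0 xM] := contract_dist (repr p).
apply/metricType_numDomainType.cvgrPdist_lt => e e0.
pose d := e / (10 + 4 * M).
have M10 : 0 < 10 + 4 * M by lra.
have d0 : 0 < d by rewrite divr_gt0.
have nt : \forall z \near (t, p), ball t d z.1 by exact/cvg_fst/nbhsx_ballx.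
have np : \forall z \near (t, p), ball p d z.2 by exact/cvg_snd/nbhsx_ballx.
near=> z.
have [z01 _] : (`[0, 1] `*` [set: Cone s]) z by near: z; exact: withinT.
have tz : `|t - z.1| < d by near: z; exact/cvg_within/nt.
have : ball p d z.2 by near: z; exact/cvg_within/np.
rewrite ballEmdist /= cone_mdistE => pz.
move: t01 z01; rewrite /= !in_itv /= => t01 z01.
apply: le_lt_trans (xM _ _ (repr z.2) t01 z01) _; rewrite !reprK.
have : d * (10 + 4 * M) = e by rewrite /d divfK// gt_eqF.
have : `|t - z.1| * M <= d * M by rewrite ler_wpM2r// ltW.
lra.
Unshelve. all: by end_near. Qed.

End contraction.

Theorem theorem4p16 (R : realType) (omega : nonprincipal_ultrafilter nat)
  (s : scaling_sequence R omega) :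
  contractible R (Cone s).
Proof.
exists (cone_base s), (@cone_contract R omega s); split.
- exact: cone_contract_continuous.
- exact: cone_contract0.
- exact: cone_contract1.
Qed.
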